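(* Let $D$ be a positive integer, let $\mathcal{H}$ be a $D$-dimensional complex Hilbert space with orthonormal basis $\{|k\rangle\}_{k=0}^{D-1}$, and let $\omega=e^{2\pi i/D}$. For $j=0,\ldots,D-1$ put $$\theta^0_j=\begin{cases}\pi j^2/D & \text{if } D \text{ is even},\\ 2\pi j^2/D & \text{if } D\text{ is odd},\end{cases}$$ and for $t\in[0,1]$ and $k=0,\ldots,D-1$ put $$a_k(t)=\frac{1}{D}\sum_{j=0}^{D-1}e^{i t\theta^0_j}\,\omega^{kj}.$$ Then the collection of $D^2$ normalized states in $\mathcal{H}\otimes\mathcal{H}$ $$|\psi_{m,n}(t)\rangle=\sum_{k=0}^{D-1}a_k(t)\,|k\oplus m\rangle\,|k\oplus m\oplus n\rangle,\qquad m,n=0,\ldots,D-1,$$ where $\oplus$ denotes addition modulo $D$, indexed by the real parameter $t\in[0,1]$, defines a family of equientangled bases that continuously interpolates between a product basis at $t=0$ and a maximally entangled basis at $t=1$.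
   Context: Every unit vector $|\psi\rangle=\sum_{j,k}\Omega_{jk}|j\rangle|k\rangle\in\mathcal{H}\otimes\mathcal{H}$ has Schmidt coefficients $\lambda_0,\ldots,\lambda_{D-1}\ge 0$ (counted with multiplicity), the squares of the singular values of the $D\times D$ matrix $\Omega$; they satisfy $\sum_k\lambda_k=1$. The state is a product state if exactly one Schmidt coefficient is non-zero (i.e. $|\psi\rangle=|\alpha\rangle|\beta\rangle$), and maximally entangled if all $\lambda_k=1/D$. Any pure-state entanglement measure depends only on the Schmidt coefficients. A family, indexed by $t\in[0,1]$, of collections of $D^2$ states is a ''family of equientangled bases that continuously interpolates between a product basis at $t=0$ and a maximally entangled basis at $t=1$'' if: (i) for each $t\in[0,1]$ the $D^2$ states form an orthonormal basis of $\mathcal{H}\otimes\mathcal{H}$; (ii) for each fixed $t$, all $D^2$ basis states have the same Schmidt coefficients (as a multiset), hence the same amount of entanglement; (iii) the states, and their (ordered) Schmidt coefficients, vary continuously with $t$; (iv) at $t=0$ every basis state is a product state; (v) at $t=1$ every basis state is maximally entangled. *)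

(* Defs.v *)
From HB Require Import structures.
From mathcomp Require Import all_boot all_order all_algebra.
From mathcomp Require Import all_classical all_reals all_analysis.
From mathcomp Require Import complex.

Set Implicit Arguments.
Unset Strict Implicit.
Unset Printing Implicit Defensive.

Import Order.TTheory GRing.Theory Num.Theory numFieldNormedType.Exports.
Local Open Scope ring_scope.
Local Open Scope complex_scope.
Local Open Scope sesquilinear_scope.

(* A finite-dimensional complex Hilbert space is a [vectType R[i]] with a
   positive definite Hermitian form, linear in its FIRST argument and
   conjugate-linear in the second. *)
Section HilbertSpaces.
Variable R : realType.

Definition orthonormal_basis (I : finType) (V : vectType R[i])
    (dot : {dot V for Num.conj}) (b : I -> V) : bool :=
  orthonormal dot [seq b i | i : I] && basis_of fullv [seq b i | i : I].

Definition hilbert_norm (V : vectType R[i]) (dot : {dot V for Num.conj})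
    (v : V) : R :=
  Num.sqrt (complex.Re (dot v v)).

(* [T], with the bilinear map [tens], is the Hilbert tensor product of [H]
   with itself; these two properties determine it up to a unique isometry. *)
Record is_hilbert_tensor (H T : vectType R[i])
    (dotH : {dot H for Num.conj}) (dotT : {dot T for Num.conj})
    (tens : {bilinear H -> H -> T}) : Prop := IsHilbertTensor {
  tens_dot : forall a b c d : H,
    dotT (tens a b) (tens c d) = dotH a c * dotH b d ;
  tens_span : forall U : {vspace T},
    (forall a b : H, tens a b \in U) -> U = fullv
}.

End HilbertSpaces.

Section Schmidt.
Variable R : realType.

(* The square roots of the eigenvalues, with multiplicity, of the positive
   semidefinite matrix [Omega^* Omega], in decreasing order. *)
Definition singular_values (D : nat) (Omega : 'M[R[i]]_D) : seq R :=
  sort >=%R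
    [seq Num.sqrt (complex.Re (spectral_diag (Omega ^t Num.conj *m Omega) 0 i))
    | i : 'I_D].

Variables (D : nat) (H T : vectType R[i]) (dotT : {dot T for Num.conj}).
Variables (tens : {bilinear H -> H -> T}) (e : 'I_D -> H).

(* When [e] is an orthonormal basis,
   [v = \sum_(j, k) coef_mx v j k *: tens (e j) (e k)]. *)
Definition coef_mx (v : T) : 'M[R[i]]_D :=
  \matrix_(j, k) dotT v (tens (e j) (e k)).

Definition schmidt_coefs (v : T) : seq R :=
  [seq s ^+ 2 | s <- singular_values (coef_mx v)].

Definition product_state (v : T) : Prop :=
  count (fun x : R => x != 0) (schmidt_coefs v) = 1%N.

Definition maximally_entangled (v : T) : Prop :=
  {in schmidt_coefs v, forall x, x = D%:R^-1}.

Local Open Scope classical_set_scope.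

Record equientangled_interpolation (st : R -> 'I_D * 'I_D -> T) : Prop :=
  EquientangledInterpolation {
  ei_basis : forall t : R, 0 <= t <= 1 -> orthonormal_basis dotT (st t) ;
  ei_equientangled : forall t : R, 0 <= t <= 1 -> forall p q,
    perm_eq (schmidt_coefs (st t p)) (schmidt_coefs (st t q)) ;
  ei_continuous_states : forall p (t0 : R), 0 <= t0 <= 1 ->
    hilbert_norm dotT (st t p - st t0 p) @[t --> within `[0, 1] (nbhs t0)]
      --> (0 : R) ;
  ei_continuous_schmidt : forall p (k : 'I_D),
    {within `[0, 1], continuous (fun t : R => (schmidt_coefs (st t p))`_k)} ;
  ei_product : forall p, product_state (st 0 p) ;
  ei_maximally_entangled : forall p, maximally_entangled (st 1 p)
}.

End Schmidt.

Section States.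
Variable R : realType.

Definition expi (x : R) : R[i] := cos x +i* sin x.

Definition omega (D : nat) : R[i] := expi (2 * pi / D%:R).

Definition theta0 (D j : nat) : R :=
  if odd D then 2 * pi * j%:R ^+ 2 / D%:R else pi * j%:R ^+ 2 / D%:R.

Definition amplitude (D : nat) (t : R) (k : nat) : R[i] :=
  D%:R^-1 * \sum_(j < D) expi (t * theta0 D j) * omega D ^+ (k * j).

(* Addition modulo [D]; ['I_D] has a canonical one only for [D] of the form
   [n.+1]. *)
Definition addm (D : nat) (k m : 'I_D) : 'I_D :=
  Ordinal (ltn_pmod (k + m) (leq_ltn_trans (leq0n k) (ltn_ord k))).

Definition psi (D : nat) (H T : vectType R[i]) (tens : {bilinear H -> H -> T})
    (e : 'I_D -> H) (t : R) (mn : 'I_D * 'I_D) : T :=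
  \sum_(k < D) amplitude D t k *:
    tens (e (addm k mn.1)) (e (addm (addm k mn.1) mn.2)).

End States.

(* Main.v *)
(** The amplitudes [a_k(t)] are the discrete Fourier transform of the unimodular
    vector [c_j = exp(i t theta_j)].  Parseval turns unimodularity into
    [\sum_k a_k conj(a_(k+r)) = [r = 0]], which is exactly orthonormality of the
    [psi_(m,n)].  The coefficient matrix of each [psi_(m,n)(t)] is a permuted
    diagonal matrix with entries [a_k(t)], so its Schmidt coefficients are the
    [|a_k(t)|^2], independently of [m, n]; they depend continuously on [t], even
    after sorting, because sorting is 1-Lipschitz for the sup norm.  At [t = 0]
    the vector [c] is constant, so [a_k = [k = 0]].  At [t = 1] it is a quadratic
    chirp, [c_(j+l) = c_j c_l z^(jl)] on Z/D with [z] a primitive [D]-th root of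
    unity, and the Gauss sum computation gives [|a_k|^2 = 1/D]. *)

Require Import Defs.
From HB Require Import structures.
From mathcomp Require Import all_boot all_order all_algebra.
From mathcomp Require Import all_classical all_reals all_analysis.
From mathcomp Require Import complex ring lra.

Set Implicit Arguments.
Unset Strict Implicit.
Unset Printing Implicit Defensive.

Import ComplexField.Normc.
Import Order.TTheory GRing.Theory Num.Theory numFieldNormedType.Exports.
Local Open Scope ring_scope.

(** * Discrete Fourier transform over a primitive root of unity *)

Section RootsOfUnity.
Variables (C : numClosedFieldType) (n : nat) (w : C).
Hypothesis w_prim : n.+1.-primitive_root w.
Implicit Types (k r : 'I_n.+1) (c : 'I_n.+1 -> C).

Lemma prim_root_conjV : w^-1 = w^*%R.
Proof.
have w1 : `|w| = 1.
  apply/eqP; rewrite -(@pexpr_eq1 _ _ n.+1) ?normr_ge0// -normrX.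
  by rewrite (prim_expr_order w_prim) normr1.
by rewrite invC_norm w1 expr1n invr1 mul1r.
Qed.

Lemma prim_rootV : n.+1.-primitive_root w^-1.
Proof.
rewrite /primitive_root_of_unity /=; apply/forallP => i.
have /andP[_ /forallP/(_ i)] := w_prim.
by rewrite !unity_rootE exprVn invr_eq1.
Qed.

Lemma sum_expr_unity (z : C) : z ^+ n.+1 = 1 ->
  \sum_(k < n.+1) z ^+ k = if z == 1 then n.+1%:R else 0.
Proof.
move=> zn; case: eqP => [->|/eqP z1].
  under eq_bigr do rewrite expr1n.
  by rewrite sumr_const card_ord.
have /eqP := subrX1 z n.+1.
by rewrite zn subrr eq_sym mulf_eq0 subr_eq0 (negPf z1) => /eqP.
Qed.

Lemma sum_prim_root (k : nat) :
  \sum_(i < n.+1) w ^+ (k * i) = if (n.+1 %| k)%N then n.+1%:R else 0.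
Proof.
under eq_bigr do rewrite exprM.
rewrite sum_expr_unity; last by rewrite exprAC (prim_expr_order w_prim) expr1n.
by rewrite (prim_order_dvd w_prim).
Qed.

Lemma dvdn_ord k : (n.+1 %| k)%N = (k == 0).
Proof. by rewrite /dvdn modn_small. Qed.

(** Normalizing by [n.+1] rather than its square root makes the transform of a unimodular vector a
    unit vector. *)
Definition dft c k : C := n.+1%:R^-1 * \sum_(j < n.+1) c j * w ^+ (k * j).

Lemma dft1 k : dft (fun=> 1) k = (k == 0)%:R.
Proof.
rewrite /dft; under eq_bigr do rewrite mul1r.
rewrite sum_prim_root dvdn_ord; case: eqP => _; last by rewrite mulr0.
by rewrite mulVf// pnatr_eq0.
Qed.

Lemma dft_conj c k :
  (dft c k)^*%R = n.+1%:R^-1 * \sum_(j < n.+1) (c j)^*%R * w^-1 ^+ (k * j).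
Proof.
rewrite /dft rmorphM fmorphV rmorph_nat rmorph_sum; congr (_ * _).
by apply: eq_bigr => j _; rewrite rmorphM rmorphXn /= prim_root_conjV.
Qed.

Lemma dft_mul_conj c k l : dft c k * (dft c l)^*%R = n.+1%:R^-1 ^+ 2 *
  \sum_(i < n.+1) \sum_(j < n.+1)
    c i * (c j)^*%R * (w ^+ (k * i) * w^-1 ^+ (l * j)).
Proof.
rewrite dft_conj /dft mulrACA -expr2; congr (_ * _).
rewrite mulr_suml; apply: eq_bigr => i _.
by rewrite mulr_sumr; apply: eq_bigr => j _; rewrite mulrACA.
Qed.

(** The sum [k + r] is reduced modulo [n.+1], which powers of an [n.+1]-th root of unity do not
    see. *)
Lemma expr_ordD (z : C) k r (j : nat) : z ^+ n.+1 = 1 ->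
  z ^+ ((k + r)%R * j) = z ^+ (k * j) * z ^+ (r * j).
Proof.
by move=> z1; rewrite exprM /= expr_mod// -exprM mulnDl exprD.
Qed.

Lemma sum_prim_root_ortho (i j : 'I_n.+1) :
  \sum_(k < n.+1) w ^+ (k * i) * w^-1 ^+ (k * j) = if i == j then n.+1%:R else 0.
Proof.
have w0 : w != 0 by rewrite (prim_root_eq0 w_prim).
under eq_bigr do rewrite ![(_ * nat_of_ord i)%N]mulnC
  ![(_ * nat_of_ord j)%N]mulnC !exprM -exprMn.
rewrite sum_expr_unity; last first.
  by rewrite exprMn !(exprAC _ _ n.+1) (prim_expr_order w_prim)
    (prim_expr_order prim_rootV) !expr1n mulr1.
rewrite exprVn -(inj_eq (mulIf (expf_neq0 j w0))) mulfVK ?expf_neq0// mul1r.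
by rewrite (eq_prim_root_expr w_prim) !modn_small.
Qed.

(** Expand into a double sum over [i], [j] and sum over [k] first: orthogonality of characters keeps
    only [i = j], unimodularity removes [c], and a geometric sum in [w^-1 ^+ r] remains. *)
Lemma dft_parseval c r : (forall j, c j * (c j)^*%R = 1) ->
  \sum_k dft c k * (dft c (k + r))^*%R = (r == 0)%:R.
Proof.
move=> c1; under eq_bigr do rewrite dft_mul_conj.
rewrite -mulr_sumr exchange_big /=.
have N0 : n.+1%:R != 0 :> C by rewrite pnatr_eq0.
transitivity (n.+1%:R^-1 ^+ 2 * \sum_(i < n.+1) w^-1 ^+ (r * i) * n.+1%:R).
  congr (_ * _); apply: eq_bigr => i _; rewrite exchange_big /= (bigD1 i)//=.
  have E j : \sum_(k < n.+1) c i * (c j)^*%R * (w ^+ (k * i) * w^-1 ^+ ((k + r)%R * j)) =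
      c i * (c j)^*%R * w^-1 ^+ (r * j) * if i == j then n.+1%:R else 0.
    rewrite -sum_prim_root_ortho mulr_sumr; apply: eq_bigr => k _.
    rewrite expr_ordD ?(prim_expr_order prim_rootV)//.
    set X := w ^+ _; set Y := _ ^+ (k * j); set Z := _ ^+ (r * j).
    by ring.
  rewrite E c1 eqxx mul1r big1 ?addr0// => j ji.
  by rewrite E eq_sym (negPf ji) mulr0.
rewrite -mulr_suml; under eq_bigr do rewrite exprM.
rewrite sum_expr_unity; last by rewrite exprAC (prim_expr_order prim_rootV) expr1n.
rewrite -(prim_order_dvd prim_rootV) dvdn_ord; case: eqP => _.
  by rewrite -expr2 -exprMn mulVf// expr1n.
by rewrite mul0r mulr0.
Qed.

(** In the double sum for the squared modulus, the shift [j -> j + l] cancels [c l] against its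
    conjugate and leaves [z ^+ (j * l)] as the only dependence on [l]. Summing over [l] then kills
    every term except [j = 0]. *)
Lemma dft_chirp (c : 'I_n.+1 -> C) (z : C) : n.+1.-primitive_root z ->
    (forall j, c j * (c j)^*%R = 1) ->
    (forall j l, c (j + l) = c j * c l * z ^+ (j * l)) ->
  forall k, dft c k * (dft c k)^*%R = n.+1%:R^-1.
Proof.
move=> z_prim c1 cD k; rewrite dft_mul_conj exchange_big /=.
have N0 : n.+1%:R != 0 :> C by rewrite pnatr_eq0.
have w0 : w != 0 by rewrite (prim_root_eq0 w_prim).
transitivity (n.+1%:R^-1 ^+ 2 *
    \sum_(l < n.+1) \sum_(j < n.+1) c j * w ^+ (k * j) * z ^+ (j * l)).
  congr (_ * _); apply: eq_bigr => l _.
  rewrite (reindex_inj (addIr l)) /=; apply: eq_bigr => j _.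
  rewrite cD [(k * (j + l)%R)%N]mulnC expr_ordD ?(prim_expr_order w_prim)//.
  rewrite ![(_ * nat_of_ord k)%N]mulnC -[w ^+ _ * _ * _]mulrA exprVn mulfV ?expf_neq0// mulr1.
  transitivity (c l * (c l)^*%R * (c j * w ^+ (k * j) * z ^+ (j * l))); last by rewrite c1 mul1r.
  set X := w ^+ _; set Y := z ^+ _; set A := c j; set B := c l; set B' := (_)^*%R.
  by ring.
rewrite exchange_big /=; under eq_bigr => j _ do rewrite -mulr_sumr.
rewrite (bigD1 0)//= [X in _ + X]big1 ?addr0 => [|j j0]; last first.
  under eq_bigr do rewrite exprM.
  rewrite sum_expr_unity; last by rewrite exprAC (prim_expr_order z_prim) expr1n.
  by rewrite -(prim_order_dvd z_prim) dvdn_ord (negPf j0) mulr0.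
(* The chirp equation at [(0, 0)] says that [c 0] is idempotent, and unimodularity makes it
   non-zero. *)
have c0 : c 0 = 1.
  have := cD 0 0; rewrite addr0 muln0 expr0 mulr1 => h.
  have c00 : c 0 != 0 by apply/eqP => c0; have /eqP := c1 0; rewrite c0 mul0r eq_sym oner_eq0.
  by apply: (mulfI c00); rewrite -h mulr1.
rewrite c0 muln0 expr0 !mul1r sumr_const card_ord.
by rewrite expr2 -mulrA mulVf// mulr1.
Qed.
End RootsOfUnity.

(** * The phases [expi], the quadratic chirp, and the amplitudes with their continuity *)

Section Expi.
Variable R : realType.
Implicit Types x y : R.
Local Open Scope complex_scope.

Lemma expiD x y : expi (x + y) = expi x * expi y.
Proof.
rewrite /expi cosD sinD; apply/eqP; rewrite eq_complex /= eqxx /=.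
by rewrite addrC mulrC [X in _ + X]mulrC eqxx.
Qed.

Lemma expi0 : expi 0 = 1 :> R[i].
Proof. by rewrite /expi cos0 sin0. Qed.

Lemma expiMn x n : expi (x *+ n) = expi x ^+ n.
Proof.
by elim: n => [|n IH]; rewrite ?mulr0n ?expi0// mulrS expiD IH exprS.
Qed.

Lemma expi_conj x : (expi x)^*%R = expi (- x).
Proof. by rewrite /expi cosN sinN. Qed.

Lemma expi_mul_conj x : expi x * (expi x)^*%R = 1.
Proof. by rewrite expi_conj -expiD subrr expi0. Qed.

Lemma expi2pi : expi (2 * pi) = 1 :> R[i].
Proof. by rewrite mulr_natl /expi cos2pi sin2pi. Qed.

(** Half-angle formula: [cos x] is 1 minus twice the square of [sin (x / 2)], and this sine is
    positive. *)
Lemma expi_neq1 x : 0 < x < 2 * pi -> expi x != 1.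
Proof.
move=> /andP[x0 x2]; apply/eqP => -[c1 _].
have : cos ((x / 2) *+ 2) = 1 by rewrite -mulr_natr divfK ?pnatr_eq0.
have : 0 < sin (x / 2) by apply: sin_gt0_pi; lra.
rewrite cos_mulr2n cos2sin2.
set s := sin _ => s0 h.
have : 0 < s ^+ 2 by rewrite exprn_gt0.
by lra.
Qed.

Lemma omega_prim n : n.+1.-primitive_root (omega R n.+1).
Proof.
apply/andP; split => //; apply/forallP => i; rewrite unity_rootE /omega.
have N0 : 0 < n.+1%:R :> R by rewrite ltr0n.
rewrite -expiMn -(mulr_natr _ i.+1) eqSS; apply/eqP.
have := ltn_ord i; rewrite ltnS leq_eqVlt => /orP[/eqP ->|lt_in].
  by rewrite divfK ?lt0r_neq0// expi2pi !eqxx.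
rewrite (ltn_eqF lt_in); apply/negbTE/expi_neq1.
rewrite mulrAC divr_gt0 ?mulr_gt0 ?pi_gt0 ?ltr0n//=.
by rewrite ltr_pdivrMr// ltr_pM2l ?mulr_gt0 ?pi_gt0 ?ltr0n// ltr_nat.
Qed.

Lemma amplitude_dft n (t : R) (k : 'I_n.+1) :
  amplitude n.+1 t k = dft (omega R n.+1) (fun j => expi (t * theta0 R n.+1 j)) k.
Proof. by []. Qed.

(* The factor [h = (odd D).+1] treats both parities at once: [h * D] is always
   even, whence periodicity mod [D], and [h] is always coprime to [D], whence
   [omega ^+ h] is still a primitive root. *)
Lemma theta0E D j : theta0 R D j = (odd D).+1%:R * pi * j%:R ^+ 2 / D%:R.
Proof. by rewrite /theta0; case: odd; rewrite ?mul1r. Qed.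

Lemma expi_theta0D n (j l : nat) :
  expi (theta0 R n.+1 (j + l)) = expi (theta0 R n.+1 j) * expi (theta0 R n.+1 l)
    * omega R n.+1 ^+ ((odd n.+1).+1 * (j * l)).
Proof.
have N0 : n.+1%:R != 0 :> R by rewrite pnatr_eq0.
rewrite /omega -expiMn -!expiD !theta0E; congr expi.
rewrite -(mulr_natr (2 * pi / _)) !natrM natrD.
set h := (odd _).+1%:R.
by field.
Qed.

(** Periodicity lets the chirp identity, proved for natural numbers, pass to addition in
    ['I_n.+1]. *)
Lemma expi_theta0_mod n (j : nat) :
  expi (theta0 R n.+1 (j %% n.+1)) = expi (theta0 R n.+1 j).
Proof.
have N0 : n.+1%:R != 0 :> R by rewrite pnatr_eq0.
have chirp_mul q : expi (theta0 R n.+1 (q * n.+1)) = 1.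
  (* The phase at [q * n.+1] is [pi] times this product; its evenness makes it a multiple of
     [2 * pi]. *)
  have [m Em] : exists m, ((odd n.+1).+1 * (q * q * n.+1) = m.*2)%N.
    exists ((odd n.+1).+1 * (q * q * n.+1))./2.
    by rewrite even_halfK// !oddM /=; case: (odd n); rewrite /= ?andbF.
  rewrite theta0E (_ : _ / _ = (2 * pi) *+ m) ?expiMn ?expi2pi ?expr1n//.
  have : ((odd n.+1).+1 * (q * q * n.+1))%:R = (2 * m)%:R :> R by rewrite Em mul2n.
  rewrite !natrM => E.
  rewrite -(mulr_natr (2 * pi) m); move: E; set h := (odd _).+1%:R => E.
  transitivity (pi * (h * (q%:R * q%:R * n.+1%:R)) :> R); first by field.
  by rewrite E; ring.
rewrite [in RHS](divn_eq j n.+1) expi_theta0D chirp_mul mul1r.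
rewrite [((_ %/ _) * _)%N]mulnC -mulnA mulnCA exprM (prim_expr_order (omega_prim n)).
by rewrite expr1n mulr1.
Qed.

Lemma coprime_odd n : coprime (odd n).+1 n.
Proof. by case: (boolP (odd n)) => [|_]; rewrite ?coprime2n ?coprime1n. Qed.

Lemma amplitude1 n (k : 'I_n.+1) :
  amplitude n.+1 (1 : R) k * (amplitude n.+1 (1 : R) k)^*%R = n.+1%:R^-1.
Proof.
rewrite amplitude_dft.
apply: (dft_chirp (omega_prim n) (z := omega R n.+1 ^+ (odd n.+1).+1)).
- by rewrite (prim_root_exp_coprime _ (omega_prim n)) coprime_odd.
- by move=> j; exact: expi_mul_conj.
- by move=> j l; rewrite !mul1r /= expi_theta0_mod expi_theta0D exprM.
Qed.

Lemma amplitude0 n (k : 'I_n.+1) : amplitude n.+1 (0 : R) k = (k == 0)%:R.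
Proof.
rewrite amplitude_dft -(dft1 (omega_prim n)) /dft.
by congr (_ * _); apply: eq_bigr => j _; rewrite mul0r expi0.
Qed.

Lemma amplitude_parseval n (t : R) (r : 'I_n.+1) :
  \sum_(k < n.+1) amplitude n.+1 t k * (amplitude n.+1 t (k + r)%R)^*%R = (r == 0)%:R.
Proof.
rewrite -(dft_parseval (omega_prim n) (c := fun j => expi (t * theta0 R n.+1 j))).
  by apply: eq_bigr => k _; rewrite !amplitude_dft.
by move=> j; exact: expi_mul_conj.
Qed.

(** Separating real and imaginary parts reduces continuity to that of the real [cos] and [sin]. *)
Lemma amplitudeE D (t : R) k : amplitude D t k =
  (D%:R^-1 * \sum_(j < D) cos (t * theta0 R D j + (2 * pi / D%:R) *+ (k * j))) +i*
  (D%:R^-1 * \sum_(j < D) sin (t * theta0 R D j + (2 * pi / D%:R) *+ (k * j))).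
Proof.
rewrite /amplitude.
under eq_bigr do rewrite /omega -expiMn -expiD.
have -> : D%:R^-1 = (D%:R^-1)%:C :> R[i] by rewrite fmorphV rmorph_nat.
elim/big_rec3: _ => [|i a b z _ IH]; rewrite ?mulr0 //.
by rewrite !mulrDr IH /expi; simpc.
Qed.

Local Open Scope classical_set_scope.

Lemma continuous_trig_sum D (f : R -> R) (a b : 'I_D -> R) : continuous f ->
  continuous (fun t : R => D%:R^-1 * \sum_(j < D) f (t * a j + b j)).
Proof.
move=> fc t.
have fj j : {for t, continuous (fun t : R => f (t * a j + b j))}.
  apply: (@continuous_comp _ _ _ (fun t : R => t * a j + b j) f t _ (fc _)).
  apply: cvgD; last exact: cvg_cst.
  by apply: cvgM; [exact: cvg_id | exact: cvg_cst].
apply: cvgM; first exact: cvg_cst.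
by apply: cvg_big => [|j _]; [exact: add_continuous | exact: fj].
Qed.

Lemma continuous_Re_amplitude D k :
  continuous (fun t : R => complex.Re (amplitude D t k)).
Proof.
rewrite (_ : (fun t => _) = fun t : R => D%:R^-1 * \sum_(j < D)
    cos (t * theta0 R D j + (2 * pi / D%:R) *+ (k * j))); last first.
  by apply/funext => t; rewrite amplitudeE.
exact: continuous_trig_sum (@continuous_cos R).
Qed.

Lemma continuous_Im_amplitude D k :
  continuous (fun t : R => complex.Im (amplitude D t k)).
Proof.
rewrite (_ : (fun t => _) = fun t : R => D%:R^-1 * \sum_(j < D)
    sin (t * theta0 R D j + (2 * pi / D%:R) *+ (k * j))); last first.
  by apply/funext => t; rewrite amplitudeE.
exact: continuous_trig_sum (@continuous_sin R).
Qed.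

(** The offset [z] serves two uses: [z = 0] for the Schmidt coefficients, and [z] the amplitude at
    [t0] for continuity of the states. *)
Lemma continuous_normc_amplitude D k (z : R[i]) :
  continuous (fun t : R => normc (amplitude D t k - z)).
Proof.
rewrite (_ : (fun t => _) = fun t : R => Num.sqrt (
    (complex.Re (amplitude D t k) - complex.Re z) ^+ 2 +
    (complex.Im (amplitude D t k) - complex.Im z) ^+ 2)); last first.
  by apply/funext => t; case: (amplitude D t k) => a b; case: z.
move=> t; apply: (@continuous_comp _ _ _ (fun t => _ : R) Num.sqrt t _ (@sqrt_continuous R _)).
have Rc : {for t, continuous (fun t : R => complex.Re (amplitude D t k) - complex.Re z)}.
  by apply: cvgB; [exact: continuous_Re_amplitude | exact: cvg_cst].
have Ic : {for t, continuous (fun t : R => complex.Im (amplitude D t k) - complex.Im z)}.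
  by apply: cvgB; [exact: continuous_Im_amplitude | exact: cvg_cst].
exact: cvgD (cvgM Rc Rc) (cvgM Ic Ic).
Qed.

End Expi.

(** * Spectrum of a diagonal matrix *)

Section Spectral.
Variable C : numClosedFieldType.
Local Open Scope sesquilinear_scope.

Lemma char_poly_conj n (P A : 'M[C]_n) : P \in unitmx ->
  char_poly (invmx P *m A *m P) = char_poly A.
Proof.
move=> Pu; rewrite /char_poly /char_poly_mx.
have E : 'X%:M - map_mx polyC (invmx P *m A *m P) =
  map_mx polyC (invmx P) *m ('X%:M - map_mx polyC A) *m map_mx polyC P.
  rewrite mulmxBr mulmxBl !map_mxM; congr (_ - _).
  by rewrite mul_mx_scalar -scalemxAl -map_mxM mulVmx// map_mx1 scalemx1.
rewrite E !det_mulmx mulrC mulrA -det_mulmx -map_mxM mulmxV// map_mx1.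
by rewrite det1 mul1r.
Qed.

Lemma char_poly_diag_mx n (d : 'rV[C]_n) :
  char_poly (diag_mx d) = \prod_(i < n) ('X - (d 0 i)%:P).
Proof.
rewrite char_poly_trig ?diag_mx_is_trig//.
by apply: eq_bigr => i _; rewrite mxE eqxx.
Qed.

(** The spectral theorem gives no control on the order of the eigenvalues; comparing characteristic
    polynomials identifies them as a multiset. *)
Lemma perm_spectral_diag_mx n (d : 'rV[C]_n) :
  perm_eq [seq spectral_diag (diag_mx d) 0 i | i : 'I_n] [seq d 0 i | i : 'I_n].
Proof.
apply: prod_XsubC_eq; rewrite !big_image /= -!char_poly_diag_mx.
have /orthomx_spectralP E : diag_mx d \is normalmx.
  apply/normalmxP; rewrite tr_diag_mx map_diag_mx; exact: diag_mxC.
by rewrite [in RHS]E char_poly_conj// spectral_unit.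
Qed.
End Spectral.

(** * Stability and continuity of sorting *)

(** One half of the Lipschitz bound, by counting: more than [k] values of [F] are at least [x], so
    more than [k] values of [G] are at least [x - d]. Beyond the length both entries are the default
    0, where [0 <= d] suffices. *)
Lemma le_nth_sort (R : realDomainType) (I : finType) (F G : I -> R)
    (d : R) (k : nat) :
  0 <= d -> (forall i, F i - d <= G i) ->
  (sort >=%R [seq F i | i : I])`_k - d <= (sort >=%R [seq G i | i : I])`_k.
Proof.
move=> d0 FG; have [kI|kI] := ltnP k #|I|; last first.
  by rewrite !nth_default ?size_sort ?size_image// add0r oppr_le0.
set x := (sort >=%R [seq F i | i : I])`_k.
(* [nth_count_le] and [nth_count_gt] are about increasing sequences, hence the
   dual order [R^d]. *)
have sorted_dual (H : I -> R) : sorted <=%O (sort >=%R [seq H i | i : I] : seq R^d).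
  by apply: sort_sorted => a b; apply: le_total.
(* If at most [k] values reached [x], the sorted entry at index [k], which is [x], would be smaller
   than [x]. *)
have kF : (k < count (fun y : R => (x <= y)%R) [seq F i | i : I])%N.
  rewrite ltnNge; apply/negP => h.
  suff: (x : R^d) < (sort >=%R [seq F i | i : I] : seq R^d)`_k by rewrite ltxx.
  apply: (@nth_count_gt _ R^d x 0) => //.
  rewrite size_sort size_map -cardE kI andbT.
  by rewrite (permP (permEl (perm_sort _ _))).
apply: (@nth_count_le _ R^d (x - d) 0) => //.
rewrite (permP (permEl (perm_sort _ _))) (leq_trans kF)//.
rewrite !count_map; apply: sub_count => i /= xF.
by apply: le_trans (FG i); rewrite lerD2r.
Qed.

Lemma continuous_nth_sort (R : realType) (X : topologicalType) (I : finType)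
    (F : I -> X -> R) (k : nat) :
  (forall i, continuous (F i)) ->
  continuous (fun t => (sort >=%R [seq F i t | i : I])`_k).
Proof.
move=> Fc t0; apply/cvgrPdist_le => eps eps0.
have H : \forall t \near t0, forall i, `|F i t0 - F i t| <= eps.
  apply: filter_forall => i.
  by move/cvgrPdist_le: (Fc i t0); apply.
apply: filterS H => t H.
rewrite ler_distl; apply/andP; split.
  apply: (@le_nth_sort _ _ (F^~ t) (F^~ t0)); first exact: ltW.
  by move=> i; have := H i; rewrite ler_distl => /andP[].
rewrite -lerBlDr; apply: (@le_nth_sort _ _ (F^~ t0) (F^~ t)); first exact: ltW.
by move=> i; have := H i; rewrite ler_distl => /andP[_]; rewrite lerBlDr.
Qed.

(** * Singular values of a permuted diagonal matrix *)

Section Schmidt.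
Variable R : realType.
Local Open Scope complex_scope.
Local Open Scope sesquilinear_scope.

Lemma perm_image_inj (I : finType) (T : eqType) (F : I -> T) (g : I -> I) :
  injective g -> perm_eq [seq F (g i) | i : I] [seq F i | i : I].
Proof.
move=> g_inj; rewrite /image_mem [X in perm_eq X _](map_comp F g); apply: perm_map.
have eu : uniq (enum I) := enum_uniq I.
apply: uniq_perm; rewrite ?(map_inj_uniq g_inj)// => i.
by rewrite mem_enum -(f_invF g_inj i) map_f// mem_enum.
Qed.

Lemma mulC_conj (z : R[i]) : z * z^*%R = ((normc z) ^+ 2)%:C.
Proof. by rewrite -normCK rmorphXn. Qed.

Lemma mulC_conjC (z : R[i]) : z^*%R * z = ((normc z) ^+ 2)%:C.
Proof. by rewrite mulrC mulC_conj. Qed.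

Lemma normc_ge0 (z : R[i]) : 0 <= normc z.
Proof. by case: z => a b; rewrite sqrtr_ge0. Qed.

(** Each row and each column carries a single entry [a k], so [Omega^* Omega] is diagonal, with the
    squared moduli of [a] permuted by the inverse of [g]. *)
Lemma singular_values_monomial (D : nat) (f g : 'I_D -> 'I_D) (a : 'I_D -> R[i]) :
  injective f -> injective g ->
  singular_values (\matrix_(i, j) \sum_k a k * ((f k == i) && (g k == j))%:R)
  = sort >=%R [seq normc (a k) | k : 'I_D].
Proof.
move=> f_inj g_inj; set Omega := \matrix_(i, j) _.
have OmegaE k j : Omega (f k) j = a k * (g k == j)%:R.
  rewrite mxE (bigD1 k)//= eqxx big1 ?addr0// => l lk.
  by rewrite (inj_eq f_inj) (negPf lk) mulr0.
pose d : 'rV[R[i]]_D := \row_i (normc (a (invF g_inj i)) ^+ 2)%:C.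
have OmegaTOmega : Omega ^t Num.conj *m Omega = diag_mx d.
  apply/matrixP => i j; rewrite !mxE (reindex_inj f_inj) /= (bigD1 (invF g_inj i))//=.
  rewrite big1 ?addr0 => [|k ki]; last first.
    have -> : (Omega ^t Num.conj) i (f k) = (Omega (f k) i)^*%R by rewrite !mxE.
    rewrite OmegaE.
    have /negPf -> : g k != i by apply: contra ki => /eqP <-; rewrite invF_f.
    by rewrite mulr0 rmorph0 mul0r.
  have -> : (Omega ^t Num.conj) i (f (invF g_inj i)) = (Omega (f (invF g_inj i)) i)^*%R
    by rewrite !mxE.
  rewrite !OmegaE f_invF eqxx mulr1 mulrA mulC_conjC.
  by case: eqP => _; rewrite ?mulr1 ?mulr0.
rewrite /singular_values OmegaTOmega.
apply/perm_sortP.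
- by move=> x y; apply: le_total.
- by move=> y x z yx zy; apply: le_trans zy yx.
- by move=> x y /andP[yx xy]; apply/eqP; rewrite eq_le; apply/andP.
rewrite /image_mem [X in perm_eq X _](map_comp (fun z => Num.sqrt (complex.Re z))).
apply: (perm_trans (perm_map _ (perm_spectral_diag_mx d))).
rewrite -map_comp; under eq_map do rewrite /= mxE /= sqrtr_sqr (ger0_norm (normc_ge0 _)).
exact: (perm_image_inj (fun k => normc (a k)) (can_inj (f_invF g_inj))).
Qed.

End Schmidt.

(** * The states [psi]: orthonormality, Schmidt coefficients, continuity *)

Section Equientangled.
Variables (R : realType) (n : nat) (H T : vectType R[i]).
Variables (dotH : {dot H for Num.conj}) (dotT : {dot T for Num.conj}).
Variables (tens : {bilinear H -> H -> T}) (e : 'I_n.+1 -> H).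
Hypothesis hT : is_hilbert_tensor dotH dotT tens.
Hypothesis he : orthonormal_basis dotH e.

Lemma orthonormal_imageP (I : finType) (V : vectType R[i])
    (dot : {dot V for Num.conj}) (b : I -> V) :
  (forall i j, dot (b i) (b j) = (i == j)%:R) ->
  orthonormal dot [seq b i | i : I].
Proof.
move=> bE; apply/orthonormalP; split.
  apply/injectiveP => i j bij.
  have := bE i j; rewrite -bij bE eqxx.
  by case: (i =P j) => // _ /eqP; rewrite oner_eq0.
move=> x y /mapP[i _ ->] /mapP[j _ ->]; rewrite bE.
have [->|ij] := eqVneq i j; first by rewrite eqxx.
case: eqP => // bij.
by have /eqP := bE i j; rewrite -bij bE eqxx (negPf ij) oner_eq0.
Qed.

Lemma dot_basis i j : dotH (e i) (e j) = (i == j)%:R.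
Proof.
have /andP[eo eb] := he.
have [/injectiveP e_inj eE] := orthonormalP eo.
rewrite eE ?map_f ?mem_enum//; congr (nat_of_bool _)%:R; exact: (inj_eq e_inj).
Qed.

Lemma dot_tens_basis i j k l :
  dotT (tens (e i) (e j)) (tens (e k) (e l)) = ((i == k) && (j == l))%:R.
Proof. by rewrite (tens_dot hT) !dot_basis -natrM mulnb. Qed.

(** The products of basis vectors span [T]. This upper bound is enough to make an orthonormal, hence
    free, family of that size a basis. *)
Lemma dim_tensor_le : (\dim {:T} <= n.+1 * n.+1)%N.
Proof.
have eb : basis_of fullv [seq e i | i : 'I_n.+1] by case/andP: he.
pose X := [seq tens (e p.1) (e p.2) | p : 'I_n.+1 * 'I_n.+1].
have eX : <<X>>%VS = fullv.
  apply: (tens_span hT) => a b.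
  have sp v : exists c : 'I_n.+1 -> R[i], v = \sum_i c i *: e i.
    exists (fun i => coord [tuple e i | i < n.+1] i v).
    rewrite {1}(coord_basis (X := [tuple e i | i < n.+1]) eb (memvf v)).
    by apply: eq_bigr => i _; rewrite -tnth_nth tnth_mktuple.
  have [ca ->] := sp a; have [cb ->] := sp b.
  rewrite linear_sumlz; apply: rpred_sum => i _.
  rewrite linear_sumr; apply: rpred_sum => j _.
  rewrite linearZl_LR linearZr_LR !rpredZ// memv_span//.
  by apply/mapP; exists (i, j); rewrite ?mem_enum.
rewrite -eX (leq_trans (dim_span _))// size_image.
by rewrite card_prod card_ord.
Qed.

Lemma addmE (k m : 'I_n.+1) : addm k m = (k + m)%R.
Proof. exact/val_inj. Qed.

Definition shift_tens (mn : 'I_n.+1 * 'I_n.+1) k :=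
  tens (e (k + mn.1)%R) (e (k + mn.1 + mn.2)%R).

Lemma psiE t mn : psi tens e t mn =
  \sum_(k < n.+1) amplitude n.+1 t k *: shift_tens mn k.
Proof.
by apply: eq_bigr => k _; rewrite !addmE.
Qed.

Lemma dot_shift_tens mn mn' k l : dotT (shift_tens mn k) (shift_tens mn' l) =
  ((l == k + mn.1 - mn'.1)%R && (mn.2 == mn'.2))%:R.
Proof.
rewrite dot_tens_basis; congr (nat_of_bool _)%:R.
rewrite [(l == _)%R]eq_sym subr_eq.
by case: eqP => //= ->; rewrite (inj_eq (addrI _)).
Qed.

(** Arbitrary coefficients cover both the inner products of two states at one [t] and the norm of a
    difference of states at two times. *)
Lemma dot_sum_shift (a b : 'I_n.+1 -> R[i]) mn mn' :
  dotT (\sum_(k < n.+1) a k *: shift_tens mn k) (\sum_(k < n.+1) b k *: shift_tens mn' k) =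
  (\sum_(k < n.+1) a k * (b (k + (mn.1 - mn'.1))%R)^*%R) * (mn.2 == mn'.2)%:R.
Proof.
rewrite linear_sumlz mulr_suml; apply: eq_bigr => k _.
rewrite linear_sumr (bigD1 (k + (mn.1 - mn'.1)))//= big1 ?addr0 => [|l lk].
  by rewrite linearZl_LR linearZr_LR /= dot_shift_tens addrA eqxx /= mulrA.
by rewrite linearZl_LR linearZr_LR /= dot_shift_tens -addrA (negPf lk) !mulr0.
Qed.

Lemma dot_psi t p q : dotT (psi tens e t p) (psi tens e t q) = (p == q)%:R.
Proof.
rewrite !psiE dot_sum_shift amplitude_parseval -natrM mulnb subr_eq0.
by case: p q => [m k] [m' k'].
Qed.

Lemma basis_psi t : orthonormal_basis dotT (psi tens e t).
Proof.
have on : orthonormal dotT [seq psi tens e t p | p : 'I_n.+1 * 'I_n.+1].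
  exact/orthonormal_imageP/dot_psi.
rewrite /orthonormal_basis on basisEfree (orthonormal_free on) subvf size_image.
by rewrite card_prod card_ord dim_tensor_le.
Qed.

Lemma singular_values_psi t p :
  singular_values (coef_mx dotT tens e (psi tens e t p)) =
  sort >=%R [seq normc (amplitude n.+1 t k) | k : 'I_n.+1].
Proof.
rewrite -(singular_values_monomial (fun k => amplitude n.+1 t k) (addIr p.1)
  (inj_comp (addIr p.2) (addIr p.1))).
congr singular_values; apply/matrixP => i j; rewrite !mxE psiE linear_sumlz.
apply: eq_bigr => k _.
by rewrite linearZl_LR /= dot_tens_basis.
Qed.

Lemma schmidt_coefs_psi t p : schmidt_coefs dotT tens e (psi tens e t p) =
  [seq x ^+ 2 | x <- sort >=%R [seq normc (amplitude n.+1 t k) | k : 'I_n.+1]].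
Proof. by rewrite /schmidt_coefs singular_values_psi. Qed.

Lemma product_psi p : product_state dotT tens e (psi tens e 0 p).
Proof.
rewrite /product_state schmidt_coefs_psi count_map.
rewrite (permP (permEl (perm_sort _ _))) count_map.
transitivity (count_mem (0 : 'I_n.+1) (enum 'I_n.+1)).
  apply: eq_count => k /=; rewrite amplitude0.
  case: (k =P 0) => _; last by rewrite normc0 expr0n eqxx.
  by rewrite normc1 expr1n oner_eq0.
by rewrite count_uniq_mem ?enum_uniq// mem_enum.
Qed.

Lemma maximally_entangled_psi p : maximally_entangled dotT tens e (psi tens e 1 p).
Proof.
move=> x; rewrite schmidt_coefs_psi => /mapP[y]; rewrite mem_sort => /mapP[k _ ->] ->.
have := @amplitude1 R n k; rewrite mulC_conj.
by rewrite -(rmorph_nat (real_complex R)) -fmorphV => /complexI.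
Qed.

Local Open Scope classical_set_scope.

Lemma continuous_schmidt_psi p (k : 'I_n.+1) :
  continuous (fun t : R => (schmidt_coefs dotT tens e (psi tens e t p))`_k).
Proof.
pose s (t : R) := (sort >=%R [seq normc (amplitude n.+1 t k) | k : 'I_n.+1])`_k.
have sc : continuous s.
  apply: (continuous_nth_sort (F := fun (i : 'I_n.+1) t => normc (amplitude n.+1 t i))) => i.
  have := @continuous_normc_amplitude R n.+1 i 0.
  rewrite (_ : (fun t : R => _) = fun t : R => normc (amplitude n.+1 t i))//.
  by apply/funext => t; rewrite subr0.
rewrite (_ : (fun t : R => _) = fun t => s t ^+ 2); last first.
  apply/funext => t; rewrite schmidt_coefs_psi (nth_map 0)//.
  by rewrite size_sort size_image card_ord.
by move=> t; exact: cvgM (sc t) (sc t).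
Qed.

Lemma hilbert_norm_psiB t t0 p :
  hilbert_norm dotT (psi tens e t p - psi tens e t0 p) =
    Num.sqrt (\sum_(k < n.+1) normc (amplitude n.+1 t k - amplitude n.+1 t0 k) ^+ 2).
Proof.
rewrite /hilbert_norm !psiE -sumrB.
under eq_bigr do rewrite -scalerBl.
rewrite dot_sum_shift eqxx mulr1 subrr.
under eq_bigr do rewrite addr0 mulC_conj.
by rewrite -rmorph_sum.
Qed.

(** By orthonormality of the shifted tensors, the distance is the Euclidean norm of the amplitude
    differences, a continuous function of [t] vanishing at [t0]. *)
Lemma continuous_psi p (t0 : R) :
  hilbert_norm dotT (psi tens e t p - psi tens e t0 p) @[t --> t0] --> (0 : R).
Proof.
pose g (t : R) := \sum_(k < n.+1) normc (amplitude n.+1 t k - amplitude n.+1 t0 k) ^+ 2.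
have gc : {for t0, continuous g}.
  apply: cvg_big => [|k _]; first exact: add_continuous.
  have c := @continuous_normc_amplitude R n.+1 k (amplitude n.+1 t0 k) t0.
  by apply: cvgM; exact: c.
have -> : (fun t => hilbert_norm dotT (psi tens e t p - psi tens e t0 p)) = Num.sqrt \o g.
  by apply/funext => t; rewrite hilbert_norm_psiB.
have g0 : Num.sqrt (g t0) = 0.
  by rewrite /g big1 ?sqrtr0// => k _; rewrite subrr normc0 expr0n.
have : Num.sqrt \o g @ t0 --> Num.sqrt (g t0).
  exact: (@continuous_comp _ _ _ g Num.sqrt t0 gc (@sqrt_continuous R _)).
by rewrite g0.
Qed.

End Equientangled.

Theorem theorem1 (R : realType) (D : nat) (hD : (0 < D)%N)
    (H : vectType R[i]) (dotH : {dot H for Num.conj})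
    (hdim : \dim {: H} = D)
    (e : 'I_D -> H) (he : orthonormal_basis dotH e)
    (T : vectType R[i]) (dotT : {dot T for Num.conj})
    (tens : {bilinear H -> H -> T})
    (hT : is_hilbert_tensor dotH dotT tens) :
  equientangled_interpolation dotT tens e (psi tens e).
Proof.
(* Writing [D] as [n.+1] gives the indices their group structure modulo [D]. *)
case: D hD hdim e he => [//|n] _ _ e he; split.
- by move=> t _; exact: (basis_psi hT he).
- by move=> t _ p q; rewrite !(schmidt_coefs_psi hT he).
- move=> p t0 _; apply: cvg_trans (@continuous_psi R n H T dotH dotT tens e hT he p t0).
  exact/cvg_app/cvg_within.
- by move=> p k; apply: continuous_subspaceT; exact: (continuous_schmidt_psi hT he).
- exact: (product_psi hT he).
- exact: (maximally_entangled_psi hT he).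
Qed.
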